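(* Let $(\mathbf Q,\otimes,I)$ be a dagger compact quantaloid with dagger kernels such that every object $X$ of $\mathbf Q$ has precisely one $\bot$-monic effect $X\to I$. Then $\mathbf Q$ is affine, and for any two objects $X$ and $Y$ in $\mathbf Q$, the homset $\mathbf Q(X,Y)$ is a complete orthomodular lattice with orthocomplementation $r\mapsto\neg r$ given by $\neg r=\bigvee\{s\in\mathbf Q(X,Y):r\perp s\}$, where the orthogonality relation $\perp$ on $\mathbf Q(X,Y)$ is given by $r\perp s$ if and only if $\mathrm{Tr}(r\circ s^\dagger)=\bot_I$. Moreover, the map $\mathbf Q(X,Y)\to\mathbf Q(X\otimes Y^*,I)$, $r\mapsto\llcorner r\lrcorner$, is an ortho-isomorphism.
   Context: A quantaloid is a category in which every homset is a complete lattice and composition preserves arbitrary suprema in each argument separately; $\bot_{X,Y}$ and $\top_{X,Y}$ denote the least and greatest element of $\mathbf Q(X,Y)$, and $\bot_X:=\bot_{X,X}$. A dagger category is a category with a contravariant involutive identity-on-objects functor $(-)^\dagger$; a morphism $f:X\to Y$ is a dagger mono if $f^\dagger\circ f=\mathrm{id}_X$, and a unitary if moreover $f\circ f^\dagger=\mathrm{id}_Y$. A dagger quantaloid is a quantaloid that is a dagger category such that $r\mapsto r^\dagger$ is an order isomorphism $\mathbf Q(X,Y)\to\mathbf Q(Y,X)$ for all $X,Y$. A dagger symmetric monoidal category is a symmetric monoidal dagger category with $(f\otimes g)^\dagger=f^\dagger\otimes g^\dagger$ and with unitary associator, unitors and symmetry $\sigma$. It is dagger compact if each object $X$ has a dual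 $X^*$ with unit $\eta_X:I\to X^*\otimes X$ and counit $\epsilon_X:X\otimes X^*\to I$ satisfying the zigzag identities and $\sigma_{X,X^*}\circ\epsilon_X^\dagger=\eta_X$. A dagger compact quantaloid is a dagger compact category that is a dagger quantaloid such that $(f,g)\mapsto f\otimes g$ preserves suprema in both arguments separately. It is affine if $\mathrm{id}_I=\top_{I,I}$. For $f:X\to X$, $\mathrm{Tr}(f)=\epsilon_X\circ(f\otimes\mathrm{id}_{X^*})\circ\epsilon_X^\dagger:I\to I$. For $f:X\to Y$, the coname is $\llcorner f\lrcorner=\epsilon_Y\circ(f\otimes\mathrm{id}_{Y^*}):X\otimes Y^*\to I$. An effect on $X$ is a morphism $X\to I$. A morphism $m:Y\to Z$ is a $\bot$-mono ($\bot$-monic) if for every $f:X\to Y$, $m\circ f=\bot_{X,Z}$ implies $f=\bot_{X,Y}$. A dagger kernel of $f:X\to Y$ is an equalizer of $f$ and $\bot_{X,Y}$ that is a dagger mono. A dagger quantaloid has dagger kernels if every morphism that is not a $\bot$-mono has a dagger kernel. (No zero object is assumed.) An ortholattice is a bounded lattice with an order-reversing involution $\neg$ such that $x\wedge\neg x=0$ and $x\vee\neg x=1$; it is orthomodular if $x\le y$ implies $y=x\vee(\neg x\wedge y)$. Its associated orthogonality relation is $x\perp y\iff x\le\neg y$. An ortho-isomorphism is an order isomorphism preserving $\neg$. *)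

(* Defs.v *)
From mathcomp Require Import ssreflect ssrfun ssrbool.
From mathcomp Require Import classical_sets.

Set Implicit Arguments.
Unset Strict Implicit.
Unset Printing Implicit Defensive.

Local Open Scope classical_set_scope.

Declare Scope qtd_scope.
Delimit Scope qtd_scope with Q.
Global Open Scope qtd_scope.

Reserved Notation "x ≤ y" (at level 70, no associativity).
Reserved Notation "g ∘ f" (at level 40, left associativity).
Reserved Notation "f ^†" (at level 1, left associativity, format "f ^†").
Reserved Notation "X ⊗ Y" (at level 35, right associativity).
(* [⊗] is the tensor of objects, [⊠] that of morphisms. *)
Reserved Notation "f ⊠ g" (at level 35, right associativity).

Class complete_lattice (A : Type) := CompleteLattice {
  le : A -> A -> Prop;
  sup : set A -> A;
  le_refl : forall x, le x x;
  le_trans : forall x y z, le x y -> le y z -> le x z;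
  le_anti : forall x y, le x y -> le y x -> x = y;
  sup_ub : forall (S : set A) x, S x -> le x (sup S);
  sup_least : forall (S : set A) u, (forall x, S x -> le x u) -> le (sup S) u
}.

Notation "x ≤ y" := (le x y) : qtd_scope.

Definition inf {A} {L : complete_lattice A} (S : set A) : A :=
  sup [set l | forall x, S x -> l ≤ x].
Definition bot {A} {L : complete_lattice A} : A := sup set0.
Definition top {A} {L : complete_lattice A} : A := sup setT.
Definition join {A} {L : complete_lattice A} (x y : A) : A := sup [set x; y].
Definition meet {A} {L : complete_lattice A} (x y : A) : A := inf [set x; y].

Lemma inf_lb {A} {L : complete_lattice A} (S : set A) x : S x -> inf S ≤ x.
Proof. by move=> Sx; apply: sup_least => l; apply. Qed.

Lemma inf_greatest {A} {L : complete_lattice A} (S : set A) l :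
  (forall x, S x -> l ≤ x) -> l ≤ inf S.
Proof. by move=> Sl; apply: sup_ub. Qed.

Definition preserves_sup {A B} {L : complete_lattice A}
    {L' : complete_lattice B} (f : A -> B) : Prop :=
  forall S : set A, f (sup S) = sup (f @` S).

Definition order_isomorphism {A B} {L : complete_lattice A}
    {L' : complete_lattice B} (f : A -> B) : Prop :=
  bijective f /\ forall x y, x ≤ y <-> f x ≤ f y.

Record ortholattice {A} {L : complete_lattice A} (neg : A -> A) : Prop :=
  Ortholattice {
    neg_antitone : forall x y, x ≤ y -> neg y ≤ neg x;
    neg_involutive : forall x, neg (neg x) = x;
    meet_neg : forall x, meet x (neg x) = bot;
    join_neg : forall x, join x (neg x) = top
  }.

(* Completeness is carried by the argument [L]. *)
Record complete_orthomodular_lattice {A} {L : complete_lattice A}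
    (neg : A -> A) : Prop := CompleteOrthomodularLattice {
  oml_ortholattice : ortholattice neg;
  orthomodular : forall x y, x ≤ y -> y = join x (meet (neg x) y)
}.

Definition ortho_isomorphism {A B} {L : complete_lattice A}
    {L' : complete_lattice B} (negA : A -> A) (negB : B -> B)
    (f : A -> B) : Prop :=
  order_isomorphism f /\ forall x, f (negA x) = negB (f x).

Record category := Category {
  ob :> Type;
  hom : ob -> ob -> Type;
  idm : forall X, hom X X;
  comp : forall X Y Z, hom Y Z -> hom X Y -> hom X Z;
  comp_assoc : forall W X Y Z (h : hom Y Z) (g : hom X Y) (f : hom W X),
    comp h (comp g f) = comp (comp h g) f;
  comp_id_l : forall X Y (f : hom X Y), comp (idm Y) f = f;
  comp_id_r : forall X Y (f : hom X Y), comp f (idm X) = f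
}.

Arguments hom {c} X Y.
Arguments idm {c} X.
Arguments comp {c X Y Z} g f.

Notation "g ∘ f" := (comp g f) : qtd_scope.

Definition inverse_pair {C : category} {X Y : C}
    (f : hom X Y) (g : hom Y X) : Prop :=
  g ∘ f = idm X /\ f ∘ g = idm Y.

Definition is_equalizer {C : category} {X Y E : C}
    (f g : hom X Y) (e : hom E X) : Prop :=
  f ∘ e = g ∘ e /\
  forall (Z : C) (h : hom Z X), f ∘ h = g ∘ h ->
    exists! k : hom Z E, e ∘ k = h.

Class quantaloid (C : category) := Quantaloid {
  hom_lattice : forall X Y : C, complete_lattice (hom X Y);
  comp_sup_r : forall (X Y Z : C) (g : hom Y Z),
    preserves_sup (fun f : hom X Y => g ∘ f);
  comp_sup_l : forall (X Y Z : C) (f : hom X Y),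
    preserves_sup (fun g : hom Y Z => g ∘ f)
}.

Global Existing Instance hom_lattice.

Class dagger_category (C : category) := DaggerCategory {
  dag : forall X Y : C, hom X Y -> hom Y X;
  dag_id : forall X : C, dag (idm X) = idm X;
  dag_comp : forall (X Y Z : C) (g : hom Y Z) (f : hom X Y),
    dag (g ∘ f) = dag f ∘ dag g;
  dag_involutive : forall (X Y : C) (f : hom X Y), dag (dag f) = f
}.

Arguments dag {C dagger_category X Y} f.

Notation "f ^†" := (dag f) : qtd_scope.

Definition dagger_mono {C : category} {D : dagger_category C} {X Y : C}
    (f : hom X Y) : Prop :=
  f^† ∘ f = idm X.

Definition unitary {C : category} {D : dagger_category C} {X Y : C}
    (f : hom X Y) : Prop :=
  dagger_mono f /\ f ∘ f^† = idm Y.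

Definition dagger_quantaloid (C : category) (L : quantaloid C)
    (D : dagger_category C) : Prop :=
  forall X Y : C, order_isomorphism (fun r : hom X Y => r^†).

Definition bot_mono {C : category} {L : quantaloid C} {Y Z : C}
    (m : hom Y Z) : Prop :=
  forall (X : C) (f : hom X Y), m ∘ f = bot -> f = bot.

Definition is_dagger_kernel {C : category} {L : quantaloid C}
    {D : dagger_category C} {X Y K : C} (f : hom X Y) (k : hom K X) : Prop :=
  is_equalizer f bot k /\ dagger_mono k.

Definition has_dagger_kernels (C : category) (L : quantaloid C)
    (D : dagger_category C) : Prop :=
  forall (X Y : C) (f : hom X Y), ~ bot_mono f ->
    exists (K : C) (k : hom K X), is_dagger_kernel f k.

Class symmetric_monoidal (C : category) := SymmetricMonoidal {
  munit : C;
  tens : C -> C -> C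
    where "X ⊗ Y" := (tens X Y);
  tensm : forall W X Y Z : C, hom W X -> hom Y Z -> hom (W ⊗ Y) (X ⊗ Z)
    where "f ⊠ g" := (tensm f g);
  tensm_id : forall X Y : C, idm X ⊠ idm Y = idm (X ⊗ Y);
  tensm_comp : forall (X Y Z X' Y' Z' : C) (g : hom Y Z) (f : hom X Y)
      (g' : hom Y' Z') (f' : hom X' Y'),
    (g ∘ f) ⊠ (g' ∘ f') = (g ⊠ g') ∘ (f ⊠ f');

  assoc : forall X Y Z : C, hom ((X ⊗ Y) ⊗ Z) (X ⊗ (Y ⊗ Z));
  assoc_inv : forall X Y Z : C, hom (X ⊗ (Y ⊗ Z)) ((X ⊗ Y) ⊗ Z);
  lunit : forall X : C, hom (munit ⊗ X) X;
  lunit_inv : forall X : C, hom X (munit ⊗ X);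
  runit : forall X : C, hom (X ⊗ munit) X;
  runit_inv : forall X : C, hom X (X ⊗ munit);
  braid : forall X Y : C, hom (X ⊗ Y) (Y ⊗ X);

  assoc_iso : forall X Y Z, inverse_pair (assoc X Y Z) (assoc_inv X Y Z);
  lunit_iso : forall X, inverse_pair (lunit X) (lunit_inv X);
  runit_iso : forall X, inverse_pair (runit X) (runit_inv X);
  braid_sym : forall X Y, braid Y X ∘ braid X Y = idm (X ⊗ Y);

  assoc_natural : forall (X X' Y Y' Z Z' : C)
      (f : hom X X') (g : hom Y Y') (h : hom Z Z'),
    assoc X' Y' Z' ∘ ((f ⊠ g) ⊠ h) = (f ⊠ (g ⊠ h)) ∘ assoc X Y Z;
  lunit_natural : forall (X Y : C) (f : hom X Y),
    lunit Y ∘ (idm munit ⊠ f) = f ∘ lunit X;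
  runit_natural : forall (X Y : C) (f : hom X Y),
    runit Y ∘ (f ⊠ idm munit) = f ∘ runit X;
  braid_natural : forall (X X' Y Y' : C) (f : hom X X') (g : hom Y Y'),
    braid X' Y' ∘ (f ⊠ g) = (g ⊠ f) ∘ braid X Y;

  pentagon : forall W X Y Z : C,
    assoc W X (Y ⊗ Z) ∘ assoc (W ⊗ X) Y Z =
    (idm W ⊠ assoc X Y Z) ∘ assoc W (X ⊗ Y) Z ∘ (assoc W X Y ⊠ idm Z);
  triangle : forall X Y : C,
    (idm X ⊠ lunit Y) ∘ assoc X munit Y = runit X ⊠ idm Y;
  hexagon : forall X Y Z : C,
    assoc Y Z X ∘ braid X (Y ⊗ Z) ∘ assoc X Y Z =
    (idm Y ⊠ braid X Z) ∘ assoc Y X Z ∘ (braid X Y ⊠ idm Z)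
}.

Arguments munit {C symmetric_monoidal}.
Arguments tensm {C symmetric_monoidal W X Y Z} f g.

Notation "X ⊗ Y" := (tens X Y) : qtd_scope.
Notation "f ⊠ g" := (tensm f g) : qtd_scope.

Record dagger_symmetric_monoidal (C : category) (D : dagger_category C)
    (M : symmetric_monoidal C) : Prop := DaggerSymmetricMonoidal {
  tensm_dag : forall (W X Y Z : C) (f : hom W X) (g : hom Y Z),
    (f ⊠ g)^† = f^† ⊠ g^†;
  assoc_unitary : forall X Y Z : C, unitary (assoc X Y Z);
  lunit_unitary : forall X : C, unitary (lunit X);
  runit_unitary : forall X : C, unitary (runit X);
  braid_unitary : forall X Y : C, unitary (braid X Y)
}.

Class duals (C : category) (M : symmetric_monoidal C) := Duals {
  dual : C -> C;
  eta : forall X : C, hom munit (dual X ⊗ X);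
  eps : forall X : C, hom (X ⊗ dual X) munit;
  zigzag : forall X : C,
    lunit X ∘ (eps X ⊠ idm X) ∘ assoc_inv X (dual X) X
      ∘ (idm X ⊠ eta X) ∘ runit_inv X = idm X;
  zigzag_dual : forall X : C,
    runit (dual X) ∘ (idm (dual X) ⊠ eps X) ∘ assoc (dual X) X (dual X)
      ∘ (eta X ⊠ idm (dual X)) ∘ lunit_inv (dual X) = idm (dual X)
}.

Record dagger_compact (C : category) (D : dagger_category C)
    (M : symmetric_monoidal C) (K : duals M) : Prop := DaggerCompact {
  dc_monoidal : dagger_symmetric_monoidal D M;
  eps_dag : forall X : C, braid X (dual X) ∘ (eps X)^† = eta X
}.

Record dagger_compact_quantaloid (C : category) (L : quantaloid C)
    (D : dagger_category C) (M : symmetric_monoidal C) (K : duals M) : Prop :=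
  DaggerCompactQuantaloid {
    dcq_compact : dagger_compact D K;
    dcq_quantaloid : dagger_quantaloid L D;
    tensm_sup_r : forall (W X Y Z : C) (f : hom W X),
      preserves_sup (fun g : hom Y Z => f ⊠ g);
    tensm_sup_l : forall (W X Y Z : C) (g : hom Y Z),
      preserves_sup (fun f : hom W X => f ⊠ g)
  }.

Definition affine (C : category) (L : quantaloid C)
    (M : symmetric_monoidal C) : Prop :=
  idm (@munit C M) = top.

Definition trace {C : category} {D : dagger_category C}
    {M : symmetric_monoidal C} {K : duals M} {X : C}
    (f : hom X X) : hom munit munit :=
  eps X ∘ (f ⊠ idm (dual X)) ∘ (eps X)^†.

Definition coname {C : category} {M : symmetric_monoidal C} {K : duals M}
    {X Y : C} (f : hom X Y) : hom (X ⊗ dual Y) munit :=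
  eps Y ∘ (f ⊠ idm (dual Y)).

Definition hom_orth {C : category} {L : quantaloid C} {D : dagger_category C}
    {M : symmetric_monoidal C} {K : duals M} {X Y : C}
    (r s : hom X Y) : Prop :=
  trace (r ∘ s^†) = bot.

Definition hom_neg {C : category} {L : quantaloid C} {D : dagger_category C}
    {M : symmetric_monoidal C} {K : duals M} {X Y : C}
    (r : hom X Y) : hom X Y :=
  sup [set s | hom_orth r s].

(* Main.v *)
From mathcomp Require Import ssreflect ssrfun ssrbool.
From mathcomp Require Import boolp classical_sets.
Require Import Defs.

(** The unique ⊥-monic effect on [X] must be [top], since anything above a
    ⊥-mono is a ⊥-mono; hence an effect different from [top] has a dagger
    kernel. If [k] is a dagger kernel of an effect [e], then the
    orthocomplement of [e] for the relation [a ∘ b^† = bot] is [top ∘ k^†],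
    and kernel calculus shows that the effects on an object form a complete
    orthomodular lattice. By dagger compactness [coname] is an order
    isomorphism, and [trace (r ∘ s^†) = coname r ∘ (coname s)^†], so that the
    structure is transported from effects to all homsets. *)

Set Implicit Arguments.
Unset Strict Implicit.
Unset Printing Implicit Defensive.

Local Open Scope classical_set_scope.

(** * Criteria for ortholattices and orthomodularity *)

Section Lattices.
Context {A : Type} {LA : complete_lattice A}.
Implicit Types x y z : A.

Lemma bot_le x : bot ≤ x.
Proof. exact: sup_least. Qed.

Lemma le_top x : x ≤ top.
Proof. exact: sup_ub. Qed.

Lemma le_bot x : x ≤ bot -> x = bot.
Proof. by move=> xb; apply: le_anti => //; apply: bot_le. Qed.

Lemma top_le x : top ≤ x -> x = top.
Proof. by move=> xb; apply: le_anti => //; apply: le_top. Qed.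

Lemma le_join_l x y : x ≤ join x y.
Proof. by apply: sup_ub; left. Qed.

Lemma le_join_r x y : y ≤ join x y.
Proof. by apply: sup_ub; right. Qed.

Lemma join_le x y z : x ≤ z -> y ≤ z -> join x y ≤ z.
Proof. by move=> xz yz; apply: sup_least => _ [-> | ->]. Qed.

Lemma meet_le_l x y : meet x y ≤ x.
Proof. by apply: inf_lb; left. Qed.

Lemma meet_le_r x y : meet x y ≤ y.
Proof. by apply: inf_lb; right. Qed.

Lemma le_meet x y z : z ≤ x -> z ≤ y -> z ≤ meet x y.
Proof. by move=> zx zy; apply: inf_greatest => _ [-> | ->]. Qed.

(** De Morgan: the complement of [join x (neg x)] lies below both [neg x] and [x], hence below their
    meet [bot]. *)
Lemma ortholattice_of_meet_neg (neg : A -> A) :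
  (forall x y, x ≤ y -> neg y ≤ neg x) -> (forall x, neg (neg x) = x) ->
  (forall x, meet x (neg x) = bot) -> ortholattice neg.
Proof.
move=> negS negK negI; split=> // x; apply: top_le.
rewrite -[join _ _]negK -[top]negK; apply: (negS).
apply: le_trans (bot_le _); rewrite -(negI x); apply: le_meet.
  by rewrite -[X in _ ≤ X]negK; apply: (negS); apply: le_join_r.
by apply: (negS); apply: le_join_l.
Qed.

(** Apply the cancellation hypothesis to [g = join x (meet (neg x) y)] and [y]: what lies below
    [neg g] and [y] lies below [meet (neg x) y], hence below [g] as well as [neg g]. *)
Lemma orthomodular_of_meet_bot (neg : A -> A) : ortholattice neg ->
  (forall x y, x ≤ y -> meet (neg x) y = bot -> x = y) ->
  complete_orthomodular_lattice neg.
Proof.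
move=> oA omA; split=> // x y xy; symmetry; apply: omA.
  by apply: join_le => //; apply: meet_le_r.
set g := join _ _; apply: le_bot; rewrite -(meet_neg oA g).
apply: le_meet; last exact: meet_le_l.
apply: le_trans (le_join_r _ _); apply: le_meet; last exact: meet_le_r.
apply: le_trans (meet_le_l _ _) _.
by apply: (neg_antitone oA); apply: le_join_l.
Qed.

End Lattices.

(** * Sup-preserving maps, order isomorphisms and transport of structure *)

Lemma preserves_sup_mono {A B} {LA : complete_lattice A}
    {LB : complete_lattice B} (f : A -> B) x y :
  preserves_sup f -> x ≤ y -> f x ≤ f y.
Proof.
move=> fS xy; have -> : y = sup [set x; y].
  by apply: le_anti; [apply: le_join_r | apply: join_le => //; apply: le_refl].
by rewrite fS; apply: sup_ub; exists x => //; left.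
Qed.

Lemma preserves_sup_bot {A B} {LA : complete_lattice A}
    {LB : complete_lattice B} (f : A -> B) :
  preserves_sup f -> f bot = bot.
Proof. by move=> fS; rewrite /bot fS image_set0. Qed.

Section OrderIsomorphisms.
Context {A B : Type} {LA : complete_lattice A} {LB : complete_lattice B}.
Variable f : A -> B.
Hypothesis f_iso : order_isomorphism f.

Lemma iso_sup : preserves_sup f.
Proof.
case: f_iso => -[g fK gK] fle S; apply: le_anti; last first.
  by apply: sup_least => _ [x Sx <-]; apply/fle; apply: sup_ub.
rewrite -[X in _ ≤ X]gK; apply/fle; apply: sup_least => x Sx.
by apply/fle; rewrite gK; apply: sup_ub; exists x.
Qed.

Lemma iso_join x y : f (join x y) = join (f x) (f y).
Proof. by rewrite /join iso_sup image_setU !image_set1. Qed.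

Lemma iso_meet x y : f (meet x y) = meet (f x) (f y).
Proof.
case: (f_iso) => -[g fK gK] fle; apply: le_anti.
  by apply: le_meet; apply/fle; [apply: meet_le_l | apply: meet_le_r].
rewrite -[X in X ≤ _]gK; apply/fle; apply: le_meet; apply/fle; rewrite gK.
  exact: meet_le_l.
exact: meet_le_r.
Qed.

Lemma iso_top : f top = top.
Proof.
case: (f_iso) => -[g fK gK] fle; apply: top_le.
by rewrite -[top]gK; apply/fle; apply: le_top.
Qed.

End OrderIsomorphisms.

Lemma ortho_isomorphism_oml {A B} {LA : complete_lattice A}
    {LB : complete_lattice B} (negA : A -> A) (negB : B -> B) (f : A -> B) :
  ortho_isomorphism negA negB f -> complete_orthomodular_lattice negB ->
  complete_orthomodular_lattice negA.
Proof.
move=> [fI fN] [oB omB]; case: (fI) => /bij_inj f_inj fle.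
split; first split.
- by move=> x y xy; apply/fle; rewrite !fN; apply: (neg_antitone oB); apply/fle.
- by move=> x; apply: f_inj; rewrite !fN (neg_involutive oB).
- move=> x; apply: f_inj.
  by rewrite iso_meet // fN (meet_neg oB) (preserves_sup_bot (iso_sup fI)).
- by move=> x; apply: f_inj; rewrite iso_join // fN (join_neg oB) iso_top.
- move=> x y /fle xy; apply: f_inj.
  by rewrite iso_join // iso_meet // fN; apply: omB.
Qed.

(** * Coherence of the unitors in a monoidal category *)

Section Coherence.
Context {C : category} {M : symmetric_monoidal C}.
Implicit Types X Y Z : C.

Lemma inverse_pair_epi (X Y Z : C) (f : hom X Y) (g : hom Y X)
    (a b : hom Y Z) :
  inverse_pair f g -> a ∘ f = b ∘ f -> a = b.
Proof.
move=> [_ fg] /(congr1 (fun h => h ∘ g)).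
by rewrite -!comp_assoc fg !comp_id_r.
Qed.

Lemma inverse_pair_mono (X Y Z : C) (f : hom X Y) (g : hom Y X)
    (a b : hom Z X) :
  inverse_pair f g -> f ∘ a = f ∘ b -> a = b.
Proof.
move=> [gf _] /(congr1 (fun h => g ∘ h)).
by rewrite !comp_assoc gf !comp_id_l.
Qed.

(** Through [lunit], tensoring with [munit] is naturally isomorphic to the identity functor, hence
    faithful. *)
Lemma tensm_unit_l_inj X Y (f g : hom X Y) :
  idm munit ⊠ f = idm munit ⊠ g -> f = g.
Proof.
move=> fg; apply: (inverse_pair_epi (lunit_iso X)).
by rewrite -!lunit_natural fg.
Qed.

Lemma tensm_unit_r_inj X Y (f g : hom X Y) :
  f ⊠ idm munit = g ⊠ idm munit -> f = g.
Proof.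
move=> fg; apply: (inverse_pair_epi (runit_iso X)).
by rewrite -!runit_natural fg.
Qed.

Lemma tensm_compl X Y Z W (g : hom Y Z) (f : hom X Y) :
  (g ∘ f) ⊠ idm W = (g ⊠ idm W) ∘ (f ⊠ idm W).
Proof. by rewrite -tensm_comp comp_id_l. Qed.

Lemma tensm_compr X Y Z W (g : hom Y Z) (f : hom X Y) :
  idm W ⊠ (g ∘ f) = (idm W ⊠ g) ∘ (idm W ⊠ f).
Proof. by rewrite -tensm_comp comp_id_l. Qed.

Lemma tensm_interchange X Y Z W (f : hom X Y) (g : hom Z W) :
  (f ⊠ idm W) ∘ (idm X ⊠ g) = (idm Y ⊠ g) ∘ (f ⊠ idm Z).
Proof. by rewrite -!tensm_comp !comp_id_l !comp_id_r. Qed.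

Lemma tensm_inverse_pair_l X Y Z (f : hom X Y) (g : hom Y X) :
  inverse_pair f g -> inverse_pair (f ⊠ idm Z) (g ⊠ idm Z).
Proof. by move=> [gf fg]; split; rewrite -tensm_compl ?gf ?fg tensm_id. Qed.

(** Kelly's argument: by faithfulness it suffices to check the equation tensored with [munit], where
    the pentagon and the triangle yield it. *)
Lemma lunit_tens X Y : lunit (X ⊗ Y) ∘ assoc munit X Y = lunit X ⊠ idm Y.
Proof.
apply: tensm_unit_l_inj.
apply: (inverse_pair_epi (assoc_iso munit (munit ⊗ X) Y)).
apply: (inverse_pair_epi (tensm_inverse_pair_l Y (assoc_iso munit munit X))).
rewrite tensm_compr -!comp_assoc.
pose proof (pentagon munit munit X Y) as pent; rewrite -!comp_assoc in pent.
rewrite -pent comp_assoc triangle -tensm_id -assoc_natural.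
by rewrite -triangle tensm_compl !comp_assoc assoc_natural.
Qed.

Lemma runit_tens X Y :
  (idm X ⊠ runit Y) ∘ assoc X Y munit = runit (X ⊗ Y).
Proof.
apply: tensm_unit_r_inj.
apply: (inverse_pair_mono (assoc_iso X Y munit)).
rewrite tensm_compl comp_assoc assoc_natural -triangle tensm_compr.
pose proof (pentagon X Y munit munit) as pent; rewrite -!comp_assoc in pent.
rewrite -!comp_assoc -pent comp_assoc -assoc_natural -comp_assoc tensm_id.
by rewrite triangle.
Qed.

Lemma lunit_munit : lunit munit = runit munit.
Proof.
apply: tensm_unit_r_inj; rewrite -lunit_tens -triangle; congr (_ ∘ _).
(* Naturality of [lunit] at the morphism [lunit munit] itself. *)
by apply: (inverse_pair_mono (lunit_iso munit)); rewrite lunit_natural.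
Qed.

End Coherence.

(** * Conames and their inverse *)

Section Coname.
Context {C : category} {M : symmetric_monoidal C} {K : duals M}.

(** The inverse of [coname]: the unit [eta Y] bends the input [dual Y] into an output [Y]. *)
Definition unconame {X Y : C} (g : hom (X ⊗ dual Y) munit) : hom X Y :=
  lunit Y ∘ (g ⊠ idm Y) ∘ assoc_inv X (dual Y) Y ∘ (idm X ⊠ eta Y)
    ∘ runit_inv X.

Lemma assoc_inv_natural (X X' Y Y' Z Z' : C)
    (f : hom X X') (g : hom Y Y') (h : hom Z Z') :
  ((f ⊠ g) ⊠ h) ∘ assoc_inv X Y Z = assoc_inv X' Y' Z' ∘ (f ⊠ (g ⊠ h)).
Proof.
apply: (inverse_pair_mono (assoc_iso X' Y' Z')).
pose proof (assoc_iso X Y Z) as [_ E]; pose proof (assoc_iso X' Y' Z') as [_ E'].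
by rewrite !comp_assoc E' comp_id_l assoc_natural -comp_assoc E comp_id_r.
Qed.

Lemma runit_inv_natural (X Y : C) (f : hom X Y) :
  (f ⊠ idm munit) ∘ runit_inv X = runit_inv Y ∘ f.
Proof.
apply: (inverse_pair_mono (runit_iso Y)).
pose proof (runit_iso X) as [_ E]; pose proof (runit_iso Y) as [_ E'].
by rewrite !comp_assoc E' comp_id_l runit_natural -comp_assoc E comp_id_r.
Qed.

(** Naturality moves [f] to the right end of the composite, leaving [zigzag] at [Y]. *)
Lemma conameK (X Y : C) : cancel (@coname C M K X Y) unconame.
Proof.
move=> f; rewrite /unconame /coname tensm_compl.
rewrite -[RHS]comp_id_l -[in RHS]zigzag -!comp_assoc; do 2 congr (_ ∘ _).
rewrite [LHS]comp_assoc assoc_inv_natural -comp_assoc; congr (_ ∘ _).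
rewrite tensm_id comp_assoc tensm_interchange -comp_assoc.
by rewrite runit_inv_natural.
Qed.

(** Naturality moves [g] to the left end; pentagon and triangle rebracket the rest into [idm X]
    tensored with the composite of [zigzag_dual]. *)
Lemma unconameK (X Y : C) : cancel unconame (@coname C M K X Y).
Proof.
move=> g; rewrite /unconame /coname; set V := dual Y.
rewrite !tensm_compl -lunit_tens !comp_assoc -lunit_natural.
rewrite -(comp_assoc (lunit munit ∘ _)) assoc_natural tensm_id comp_assoc.
rewrite -(comp_assoc (lunit munit)) -tensm_interchange comp_assoc.
(* Since the two unitors of [munit] agree, naturality of the right one releases [g]. *)
rewrite lunit_munit runit_natural -[RHS]comp_id_r -!comp_assoc.
congr (_ ∘ _).
have pent : assoc (X ⊗ V) Y V ∘ (assoc_inv X V Y ⊠ idm V) =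
    assoc_inv X V (Y ⊗ V) ∘ (idm X ⊠ assoc V Y V) ∘ assoc X (V ⊗ Y) V.
  apply: (inverse_pair_epi (tensm_inverse_pair_l V (assoc_iso X V Y))).
  apply: (inverse_pair_mono (assoc_iso X V (Y ⊗ V))).
  pose proof (tensm_inverse_pair_l V (assoc_iso X V Y)) as [E _].
  pose proof (assoc_iso X V (Y ⊗ V)) as [_ E'].
  rewrite -(comp_assoc (assoc (X ⊗ V) Y V)) E comp_id_r pentagon.
  by rewrite !comp_assoc E' comp_id_l.
pose proof (runit_iso X) as [_ rr]; pose proof (lunit_iso V) as [ll _].
have tri : assoc X munit V ∘ (runit_inv X ⊠ idm V) = idm X ⊠ lunit_inv V.
  have <- : (idm X ⊠ lunit_inv V) ∘ (runit X ⊠ idm V)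
      ∘ (runit_inv X ⊠ idm V) = idm X ⊠ lunit_inv V.
    by rewrite -comp_assoc -tensm_compl rr tensm_id comp_id_r.
  by rewrite -triangle comp_assoc -tensm_compr ll tensm_id comp_id_l.
rewrite (comp_assoc (assoc (X ⊗ V) Y V)) pent -!comp_assoc.
rewrite (comp_assoc (assoc X (V ⊗ Y) V)) assoc_natural -comp_assoc tri.
rewrite -(tensm_id X V) (comp_assoc (_ ⊠ eps Y)) assoc_inv_natural.
pose proof (assoc_iso X V munit) as [_ aa].
rewrite !comp_assoc -runit_tens -(comp_assoc (idm X ⊠ runit V)) aa comp_id_r.
by rewrite -!tensm_compr zigzag_dual tensm_id.
Qed.

(** The counit at [munit] is, up to a unitor, an effect [t] on [dual munit]; [f] slides past [t] and
    then through the unitor. *)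
Lemma coname_scalar (f : hom munit munit) : coname f = f ∘ eps munit.
Proof.
pose t := @eps C M K munit ∘ lunit_inv (dual munit).
have epsE : eps munit = lunit munit ∘ (idm munit ⊠ t).
  pose proof (lunit_iso (dual munit)) as [E _].
  by rewrite lunit_natural /t -comp_assoc E comp_id_r.
rewrite /coname epsE -comp_assoc -tensm_interchange.
by rewrite lunit_munit comp_assoc runit_natural comp_assoc.
Qed.

Lemma coname_trace {D : dagger_category C} (X Y : C) (r s : hom X Y) :
  dagger_symmetric_monoidal D M ->
  trace (r ∘ s^†) = coname r ∘ (coname s)^†.
Proof.
move=> dM; rewrite /trace /coname dag_comp (tensm_dag dM) dag_id tensm_compl.
by rewrite !comp_assoc.
Qed.

End Coname.

(** * Monotonicity and bottoms in a quantaloid *)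

Section Quantaloids.
Context {C : category} {L : quantaloid C}.

Lemma comp_bot_r (X Y Z : C) (g : hom Y Z) : g ∘ (bot : hom X Y) = bot.
Proof. exact: (preserves_sup_bot (comp_sup_r g)). Qed.

Lemma comp_bot_l (X Y Z : C) (f : hom X Y) : (bot : hom Y Z) ∘ f = bot.
Proof. exact: (preserves_sup_bot (comp_sup_l f)). Qed.

Lemma comp_mono (X Y Z : C) (g g' : hom Y Z) (f f' : hom X Y) :
  g ≤ g' -> f ≤ f' -> g ∘ f ≤ g' ∘ f'.
Proof.
move=> gg' ff'; apply: (le_trans (y := g ∘ f')).
  exact: (preserves_sup_mono (comp_sup_r g)).
exact: (preserves_sup_mono (comp_sup_l f')).
Qed.

Lemma bot_mono_le (X Y : C) (m n : hom X Y) : m ≤ n -> bot_mono m -> bot_mono n.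
Proof.
move=> mn bm Z f nf; apply: bm; apply: le_bot; rewrite -nf.
by apply: comp_mono => //; apply: le_refl.
Qed.

End Quantaloids.

(** * Kernel calculus *)

Section DaggerKernels.
Context {C : category} {L : quantaloid C} {D : dagger_category C}.
Hypothesis dagQ : dagger_quantaloid L D.
Hypothesis dker : has_dagger_kernels L D.

Lemma dag_bot (X Y : C) : (bot : hom X Y)^† = bot.
Proof. exact: (preserves_sup_bot (iso_sup (dagQ X Y))). Qed.

Lemma dag_le (X Y : C) (r s : hom X Y) : r ≤ s -> r^† ≤ s^†.
Proof. by case: (dagQ X Y) => _ h /h. Qed.

Lemma comp_dag_bot_sym (X Y Z : C) (r : hom X Y) (s : hom X Z) :
  r ∘ s^† = bot -> s ∘ r^† = bot.
Proof. by move=> rs; rewrite -[LHS]dag_involutive dag_comp dag_involutive rs dag_bot. Qed.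

Lemma dagger_kernel_bot (X Y Z : C) (f : hom X Y) (k : hom Z X) :
  is_dagger_kernel f k -> f ∘ k = bot.
Proof. by move=> [[-> _] _]; rewrite comp_bot_l. Qed.

Lemma dagger_kernel_factor (X Y Z W : C) (f : hom X Y) (k : hom Z X)
    (h : hom W X) :
  is_dagger_kernel f k -> f ∘ h = bot -> exists m, k ∘ m = h.
Proof.
move=> [[_ kU] _] fh; have [|m [km _]] := kU W h; last by exists m.
by rewrite fh comp_bot_l.
Qed.

Lemma dagger_kernel_dag_factor (X Y Z W : C) (f : hom X Y) (k : hom Z X)
    (h : hom X W) :
  is_dagger_kernel f k -> f ∘ h^† = bot -> exists m, h = m ∘ k^†.
Proof.
move=> fk /(dagger_kernel_factor fk) [m km]; exists m^†.
by rewrite -dag_comp km dag_involutive.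
Qed.

(** If [x] has a dagger kernel [k], then [x^†] factors through it, so [x = m ∘ k^†] and
    [m = x ∘ k = bot]. Otherwise [x] is ⊥-monic and cancels. *)
Lemma comp_dag_self_bot (X Y : C) (x : hom X Y) : x ∘ x^† = bot -> x = bot.
Proof.
move=> xx; have [/(_ _ _ xx) xb|/dker[Z [k xk]]] := pselect (bot_mono x).
  by rewrite -[x]dag_involutive xb dag_bot.
have [m xE] := dagger_kernel_dag_factor xk xx.
have : x ∘ k = bot by apply: dagger_kernel_bot xk.
case: xk => _ kk; rewrite {1}xE -comp_assoc kk comp_id_r => mb.
by rewrite xE mb comp_bot_l.
Qed.

End DaggerKernels.

(** * The orthomodular lattice of effects *)

Section Effects.
Context {C : category} {L : quantaloid C} {D : dagger_category C} {I : C}.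
Hypothesis dagQ : dagger_quantaloid L D.
Hypothesis dker : has_dagger_kernels L D.
Hypothesis eff : forall X : C, exists! e : hom X I, bot_mono e.

(** Phrased by composition instead of [trace], to suit kernel arguments; [hom_neg_effect] identifies
    it with [hom_neg]. *)
Definition effect_neg {X : C} (e : hom X I) : hom X I :=
  sup [set s | e ∘ s^† = bot].

Lemma bot_mono_top (X : C) (e : hom X I) : bot_mono e <-> e = top.
Proof.
have [d [dm dU]] := eff X.
have tm : bot_mono (top : hom X I) by apply: bot_mono_le dm; apply: le_top.
by split=> [em | ->] //; rewrite -(dU _ em) (dU _ tm).
Qed.

Lemma idm_top : idm I = top.
Proof. by apply/bot_mono_top => X f; rewrite comp_id_l. Qed.

(** Composition preserves suprema, so [effect_neg s] is itself orthogonal to [s], and orthogonality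
    passes to smaller effects. *)
Lemma le_effect_neg (X : C) (e s : hom X I) :
  e ≤ effect_neg s <-> e ∘ s^† = bot.
Proof.
split=> [es|/(comp_dag_bot_sym dagQ) se]; last exact: sup_ub.
apply: le_bot; apply: (le_trans (y := effect_neg s ∘ s^†)).
  by apply: comp_mono => //; apply: le_refl.
rewrite /effect_neg comp_sup_l; apply: sup_least => _ [t st <-].
by rewrite (comp_dag_bot_sym dagQ) //; apply: le_refl.
Qed.

Lemma effect_neg_orth (X : C) (e : hom X I) : effect_neg e ∘ e^† = bot.
Proof. by apply/le_effect_neg; apply: le_refl. Qed.

(** An effect orthogonal to [e] factors through [k^†], hence lies below [top ∘ k^†], which is
    orthogonal to [e] because [e ∘ k = bot]. *)
Lemma effect_neg_kernel (X Z : C) (e : hom X I) (k : hom Z X) :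
  is_dagger_kernel e k -> effect_neg e = top ∘ k^†.
Proof.
move=> ek; apply: le_anti.
  apply: sup_least => s /(dagger_kernel_dag_factor ek) [m ->].
  by apply: comp_mono; [apply: le_top | apply: le_refl].
apply: sup_ub; rewrite /= dag_comp dag_involutive comp_assoc.
by rewrite (dagger_kernel_bot ek) comp_bot_l.
Qed.

Lemma effect_neg_involutive (X : C) (e : hom X I) :
  effect_neg (effect_neg e) = e.
Proof.
have le_nn : e ≤ effect_neg (effect_neg e).
  by apply/le_effect_neg; apply: (comp_dag_bot_sym dagQ); apply: effect_neg_orth.
have nn_bot : bot_mono (effect_neg e) -> effect_neg (effect_neg e) = e.
  move=> bm; apply: le_anti => //; apply: sup_least => s /bm sb.
  by rewrite -[s]dag_involutive sb (dag_bot dagQ); apply: bot_le.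
have [//|/dker[W [l el]]] := pselect (bot_mono (effect_neg e)).
have [|m eE] := dagger_kernel_dag_factor (h := e) el _.
  exact: effect_neg_orth.
(* Both sides now factor through [l^†], so it remains to see that [m] is [top], that is, ⊥-monic. *)
rewrite (effect_neg_kernel el) [RHS]eE; congr (_ ∘ _); symmetry.
apply/bot_mono_top => Z f mf.
have ll : l^† ∘ l = idm W by case: el.
have elf : e ∘ (l ∘ f) = bot.
  by rewrite eE !comp_assoc -(comp_assoc m) ll comp_id_r.
(* [l ∘ f] is killed by [e] and factors through the kernel [l] of [effect_neg e]. A kernel [k] of
   [e] satisfies [k^† ∘ l = bot], so [l ∘ f] is orthogonal to itself. *)
have lf : (l ∘ f)^† ∘ (l ∘ f) = bot.
  have [bm|/dker[V [k ek]]] := pselect (bot_mono e).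
    by rewrite (bm _ _ elf) comp_bot_r.
  have [g gE] := dagger_kernel_factor ek elf.
  have : top ∘ (k^† ∘ l) = (bot : hom W I).
    by rewrite comp_assoc -(effect_neg_kernel ek) (dagger_kernel_bot el).
  have /bot_mono_top bt : (top : hom V I) = top by [].
  move/bt => kl; rewrite -{1}gE dag_comp -comp_assoc (comp_assoc k^†) kl.
  by rewrite comp_bot_l comp_bot_r.
have := lf; rewrite dag_comp -comp_assoc (comp_assoc l^†) ll comp_id_l.
rewrite -{2}[f]dag_involutive => /(comp_dag_self_bot dagQ dker) fb.
by rewrite -[f]dag_involutive fb (dag_bot dagQ).
Qed.

Lemma effect_oml (X : C) :
  complete_orthomodular_lattice (@effect_neg X).
Proof.
have negS (e f : hom X I) : e ≤ f -> effect_neg f ≤ effect_neg e.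
  move=> ef; apply/le_effect_neg/le_bot; rewrite -(effect_neg_orth f).
  by apply: comp_mono; [apply: le_refl | apply: dag_le].
apply: orthomodular_of_meet_bot.
  apply: ortholattice_of_meet_neg => //; first exact: effect_neg_involutive.
  (* Being below both [e] and its complement, [x] is orthogonal to itself. *)
  move=> e; set x := meet _ _; apply: (comp_dag_self_bot dagQ dker).
  apply: le_bot; rewrite -(effect_neg_orth e).
  by apply: comp_mono; [|apply: (dag_le dagQ)]; [apply: meet_le_r | apply: meet_le_l].
move=> e f ef efb.
have [nm|/dker[W [l fl]]] := pselect (bot_mono (effect_neg f)).
  have fb : f = bot.
    rewrite -[f]dag_involutive (nm _ f^†) ?(dag_bot dagQ) //.
    exact: effect_neg_orth.
  by rewrite fb in ef *; apply: le_bot.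
have ll : l^† ∘ l = idm W by case: fl.
have fE : f = top ∘ l^† by rewrite -(effect_neg_kernel fl) effect_neg_involutive.
have [|m eE] := dagger_kernel_dag_factor (h := e) fl _.
  by apply/le_effect_neg; apply: (negS).
(* With [f = top ∘ l^†] and [e = m ∘ l^†], equality amounts to [m] being ⊥-monic. *)
rewrite fE eE; congr (_ ∘ _); apply/bot_mono_top.
have [//|/dker[V [n mn]]] := pselect (bot_mono m).
have nn : n^† ∘ n = idm V by case: mn.
(* This effect is orthogonal to [e] because [m ∘ n = bot], and it lies below [f]. *)
have yb : top ∘ (n^† ∘ l^†) = (bot : hom X I).
  apply: le_bot; rewrite -efb; apply: le_meet.
    apply/le_effect_neg; rewrite eE dag_comp dag_involutive.
    rewrite -!comp_assoc (comp_assoc l^†) ll comp_id_l.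
    by rewrite -[n^† ∘ _]dag_involutive dag_comp !dag_involutive
      (dagger_kernel_bot mn) (dag_bot dagQ) comp_bot_r.
  rewrite fE comp_assoc; apply: comp_mono; [exact: le_top | exact: le_refl].
(* Cancelling [l] and [n] collapses the effects on [V]. As [top] is ⊥-monic, every morphism into [V]
   is [bot], so the kernel [n] of [m] is trivial. *)
have tb : (top : hom V I) = bot.
  have := congr1 (fun h => h ∘ (l ∘ n)) yb.
  by rewrite comp_bot_l -!comp_assoc (comp_assoc l^†) ll comp_id_l nn comp_id_r.
have /bot_mono_top bt : (top : hom V I) = top by [].
move=> Z g /(dagger_kernel_factor mn) [h <-].
by rewrite (bt _ h) ?comp_bot_r // tb comp_bot_l.
Qed.

End Effects.

(** * Transport from effects to homsets along conames *)

Section CompactQuantaloids.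
Context {C : category} {L : quantaloid C} {D : dagger_category C}
  {M : symmetric_monoidal C} {K : duals M}.
Hypothesis dcQ : dagger_compact_quantaloid L D K.

Let dagQ := dcq_quantaloid dcQ.
Let dM := dc_monoidal (dcq_compact dcQ).

Lemma coname_order_isomorphism (X Y : C) :
  order_isomorphism (@coname C M K X Y).
Proof.
split; first by exists unconame; [apply: conameK | apply: unconameK].
have tens_le (U V W : C) (f g : hom U V) : f ≤ g -> f ⊠ idm W ≤ g ⊠ idm W.
  exact: (preserves_sup_mono (tensm_sup_l dcQ (idm W))).
move=> r s; split=> [rs|/(tens_le _ _ Y) rs].
  by apply: comp_mono; [apply: le_refl | apply: tens_le].
rewrite -[r]conameK -[s]conameK /unconame.
by do 3![apply: comp_mono; last exact: le_refl]; apply: comp_mono; first exact: le_refl.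
Qed.

Lemma hom_orth_coname (X Y : C) (r s : hom X Y) :
  hom_orth r s <-> coname r ∘ (coname s)^† = bot.
Proof. by rewrite /hom_orth coname_trace. Qed.

Lemma coname_bot (X Y : C) : coname (bot : hom X Y) = bot.
Proof. exact: (preserves_sup_bot (iso_sup (coname_order_isomorphism X Y))). Qed.

(** A scalar [f] with [trace f = bot] is [bot]: by [coname_scalar], [coname f ∘ (coname f)^†] is
    [trace f ∘ f^†], so [coname f] is orthogonal to itself. *)
Lemma hom_orth_effect (dker : has_dagger_kernels L D) (X : C)
    (a b : hom X munit) :
  hom_orth a b <-> a ∘ b^† = bot.
Proof.
rewrite /hom_orth; set f := a ∘ b^†.
rewrite /trace -/(coname f); split=> [fb | ->]; last by rewrite coname_bot comp_bot_l.
apply: (bij_inj (proj1 (coname_order_isomorphism munit munit))).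
rewrite coname_bot; apply: (comp_dag_self_bot dagQ dker).
by rewrite {2}coname_scalar dag_comp comp_assoc fb comp_bot_l.
Qed.

Lemma hom_neg_effect (dker : has_dagger_kernels L D) (X : C)
    (e : hom X munit) :
  hom_neg e = effect_neg e.
Proof. by congr sup; apply/seteqP; split=> s; apply hom_orth_effect. Qed.

(** The trace formula makes [coname] preserve and reflect orthogonality; as an order isomorphism it
    also preserves the supremum defining [hom_neg]. *)
Lemma coname_ortho_isomorphism (dker : has_dagger_kernels L D) (X Y : C) :
  ortho_isomorphism (fun r : hom X Y => hom_neg r)
    (fun t : hom (X ⊗ dual Y) munit => hom_neg t) (fun r => coname r).
Proof.
have cI := coname_order_isomorphism X Y; split=> // r.
rewrite /hom_neg (iso_sup cI); congr sup; apply/seteqP; split=> [_ [s rs <-]|t rt].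
  by apply/(hom_orth_effect dker); apply/hom_orth_coname.
exists (unconame t); last exact: unconameK.
by apply/hom_orth_coname; rewrite unconameK; apply/(hom_orth_effect dker).
Qed.

End CompactQuantaloids.

Theorem theorem4p24 (Q : category) (L : quantaloid Q) (D : dagger_category Q)
    (M : symmetric_monoidal Q) (K : duals M)
    (hQ : dagger_compact_quantaloid L D K)
    (hker : has_dagger_kernels L D)
    (heff : forall X : Q, exists! e : hom X munit, bot_mono e) :
  affine L M /\
  (forall X Y : Q,
     complete_orthomodular_lattice (fun r : hom X Y => hom_neg r) /\
     (forall r s : hom X Y, le r (hom_neg s) <-> hom_orth r s)) /\
  (forall X Y : Q,
     ortho_isomorphism (fun r : hom X Y => hom_neg r)
       (fun t : hom (tens X (dual Y)) munit => hom_neg t)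
       (fun r : hom X Y => coname r)).
Proof.
have dagQ := dcq_quantaloid hQ.
split; first exact: (idm_top heff).
split=> X Y; last exact: coname_ortho_isomorphism.
have cO := coname_ortho_isomorphism hQ hker X Y; split.
  apply: (ortho_isomorphism_oml cO).
  have -> : (fun t : hom (X ⊗ dual Y) munit => hom_neg t) = effect_neg.
    by apply/funext => t; apply: hom_neg_effect.
  exact: effect_oml.
(* Along [coname], the claim becomes [le_effect_neg]. *)
move=> r s; case: cO => -[_ cle] cN; apply: (iff_trans (cle _ _)).
rewrite cN hom_neg_effect //.
apply: (iff_trans (le_effect_neg dagQ _ _)).
by apply: iff_sym; apply: hom_orth_coname.
Qed.
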